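(* Let $U_1,U_2,U_3,V_1,V_2,V_3$ be finite-dimensional complex vector spaces, and put $u_3=\dim U_3$, $v_3=\dim V_3$. Let $T \in U_1 \otimes U_2 \otimes U_3$ and $S \in V_1 \otimes V_2 \otimes V_3$ and assume that $T$ degenerates to $S$. Then $T^{\blacksquare\, u_3 v_3}$ restricts to $S$.
   Context: For tensors $T \in U_1 \otimes U_2 \otimes U_3$ and $S \in V_1\otimes V_2\otimes V_3$: - $T$ restricts to $S$ if there are linear maps $A_i: U_i\to V_i$ ($i=1,2,3$) with $S=(A_1\otimes A_2\otimes A_3)T$. - $T$ degenerates to $S$ if there are linear maps $A_i(\epsilon):U_i\to V_i$ ($i=1,2,3$) with entries in $\mathbb{C}[\epsilon]$, natural numbers $d,e\ge 0$ and tensors $S_1,\dots,S_e\in V_1\otimes V_2\otimes V_3$ such that $(A_1(\epsilon)\otimes A_2(\epsilon)\otimes A_3(\epsilon))T=\epsilon^d S+\epsilon^{d+1}S_1+\dots+\epsilon^{d+e}S_e$. For $p\ge 1$, $T^{\blacksquare p} = T\boxtimes\langle 1,1,p\rangle\in U_1\otimes(U_2\otimes\mathbb{C}^p)\otimes(U_3\otimes\mathbb{C}^p)$, where $\boxtimes$ is the Kronecker product and $\langle 1,1,p\rangle = e_1\otimes\sum_{l=1}^p e_l\otimes e_l \in \mathbb{C}^1\otimes\mathbb{C}^p\otimes\mathbb{C}^p$. Explicitly, if $T=\sum T_{ijk}\,e_i\otimes e_j\otimes e_k$ in bases, then $T^{\blacksquare p}=\sum_{i,j,k}\sum_{l=1}^p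 T_{ijk}\, e_i\otimes(e_j\otimes e_l)\otimes(e_k\otimes e_l)$. *)

(* Defs.v *)
From HB Require Import structures.
From mathcomp Require Import all_boot all_order all_algebra.
From mathcomp Require Import reals.
From mathcomp Require Import complex.

Set Implicit Arguments.
Unset Strict Implicit.
Unset Printing Implicit Defensive.

Import GRing.Theory.
Local Open Scope ring_scope.

(* MathComp has no tensor product of abstract vector spaces.  For
   finite-dimensional spaces we use the canonical, basis-free model
   U (x) V := Hom(U^*, V), in which u (x) v is the map f |-> f(u) v.
   The lemmas [tprod_linearl], [tprod_linearr], [tens_expand] and [dim_tens]
   show that the u_i (x) v_j form a basis when (u_i) and (v_j) do, i.e. that
   this is the usual tensor product. *)
Definition dual (F : fieldType) (U : vectType F) : vectType F := 'Hom(U, F^o).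

Definition tens (F : fieldType) (U V : vectType F) : vectType F :=
  'Hom(dual U, V).

(* U1 (x) U2 (x) U3, bracketed to the right. *)
Definition tens3 (F : fieldType) (U1 U2 U3 : vectType F) : vectType F :=
  tens U1 (tens U2 U3).

Section Tensors.
Variable F : fieldType.
Implicit Types U V : vectType F.

Definition tprod U V (u : U) (v : V) : tens U V :=
  linfun (fun f : dual U => f u *: v).

Definition dual_map U V (A : 'Hom(U, V)) : 'Hom(dual V, dual U) :=
  linfun (fun f : dual V => (f \o A)%VF).

Definition tmap U V U' V' (A : 'Hom(U, U')) (B : 'Hom(V, V')) :
    'Hom(tens U V, tens U' V') :=
  linfun (fun t : tens U V => (B \o (t \o dual_map A))%VF).

Definition tmap3 U1 U2 U3 V1 V2 V3
    (A1 : 'Hom(U1, V1)) (A2 : 'Hom(U2, V2)) (A3 : 'Hom(U3, V3)) :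
    'Hom(tens3 U1 U2 U3, tens3 V1 V2 V3) :=
  tmap A1 (tmap A2 A3).

Definition tprod_right U V (v : V) : 'Hom(U, tens U V) :=
  linfun (fun u : U => tprod u v).

Definition restricts U1 U2 U3 V1 V2 V3
    (T : tens3 U1 U2 U3) (S : tens3 V1 V2 V3) : Prop :=
  exists (A1 : 'Hom(U1, V1)) (A2 : 'Hom(U2, V2)) (A3 : 'Hom(U3, V3)),
    S = tmap3 A1 A2 A3 T.

(* The Kronecker product of T with <1,1,p> = e_1 (x) \sum_l e_l (x) e_l, with
   U1 (x) F^1 identified with U1: on pure tensors,
   u1 (x) u2 (x) u3 |-> \sum_l u1 (x) (u2 (x) e_l) (x) (u3 (x) e_l);
   see [bsquare_expand]. *)
Definition bsquare U1 U2 U3 (T : tens3 U1 U2 U3) (p : nat) :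
    tens3 U1 (tens U2 'rV[F]_p) (tens U3 'rV[F]_p) :=
  \sum_(l < p) tmap3 \1%VF (tprod_right U2 (delta_mx 0 l))
                           (tprod_right U3 (delta_mx 0 l)) T.

(* The value at x of the linear map \sum_k eps^k A_k with entries in F[eps],
   given by its sequence of coefficients A_k. *)
Definition poly_map U V (A : seq 'Hom(U, V)) (x : F) : 'Hom(U, V) :=
  \sum_(k < size A) x ^+ k *: A`_k.

Lemma linfun_linearE U V (f : U -> V) : linear f -> linfun f =1 f.
Proof.
move=> fP; pose Lm := GRing.isLinear.Build _ _ _ _ f fP.
pose Ll : {linear U -> V} := HB.pack f Lm.
exact: (lfunE Ll).
Qed.

Lemma tprodE U V (u : U) (v : V) (f : dual U) : tprod u v f = f u *: v.
Proof.
rewrite /tprod linfun_linearE //.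
by move=> a g h; rewrite add_lfunE scale_lfunE scalerDl scalerA.
Qed.

Lemma tprod_linearl U V (v : V) : linear (fun u : U => tprod u v).
Proof.
move=> a u u'; apply/lfunP => f.
by rewrite add_lfunE scale_lfunE !tprodE linearP scalerDl scalerA.
Qed.

Lemma tprod_linearr U V (u : U) : linear (fun v : V => tprod u v).
Proof.
move=> a v v'; apply/lfunP => f.
by rewrite add_lfunE scale_lfunE !tprodE scalerDr !scalerA mulrC.
Qed.

Lemma dim_tens U V : \dim {: tens U V} = (\dim {:U} * \dim {:V})%N.
Proof.
by rewrite !dimvf; change (dim U * 1 * dim V = dim U * dim V)%N; rewrite muln1.
Qed.

Lemma tens_expand U V m (e : m.-tuple U) (t : tens U V) :
  basis_of fullv e ->
  t = \sum_(i < m) tprod e`_i (t (linfun (coord e i : U -> F^o))).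
Proof.
move=> eb; apply/lfunP => f; rewrite sum_lfunE.
have {1}-> : f = \sum_(i < m) f e`_i *: linfun (coord e i : U -> F^o).
  apply/lfunP => u; rewrite sum_lfunE {1}(coord_basis eb (memvf u)) linear_sum.
  apply: eq_bigr => i _; rewrite linearZ scale_lfunE lfunE /=.
  by rewrite /GRing.scale /= mulrC.
by rewrite linear_sum; apply: eq_bigr => i _; rewrite linearZ tprodE.
Qed.

Lemma dual_mapE U V (A : 'Hom(U, V)) (f : dual V) :
  dual_map A f = (f \o A)%VF.
Proof.
rewrite /dual_map linfun_linearE //.
by move=> a g h; rewrite comp_lfunDl comp_lfunZl.
Qed.

Lemma tmapE U V U' V' (A : 'Hom(U, U')) (B : 'Hom(V, V')) (t : tens U V) :
  tmap A B t = (B \o (t \o dual_map A))%VF.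
Proof.
rewrite /tmap linfun_linearE //.
move=> a g h; rewrite comp_lfunDl comp_lfunDr -comp_lfunZl.
by rewrite -comp_lfunZr.
Qed.

Lemma tmap_tprod U V U' V' (A : 'Hom(U, U')) (B : 'Hom(V, V')) u v :
  tmap A B (tprod u v) = tprod (A u) (B v).
Proof.
apply/lfunP => f.
by rewrite tmapE !comp_lfunE dual_mapE !tprodE linearZ comp_lfunE.
Qed.

Lemma tprod_rightE U V (v : V) (u : U) : tprod_right U v u = tprod u v.
Proof.
by rewrite /tprod_right linfun_linearE //; apply: tprod_linearl.
Qed.

Lemma bsquare_expand U1 U2 U3 m n q (c : 'I_m -> 'I_n -> 'I_q -> F)
    (e1 : 'I_m -> U1) (e2 : 'I_n -> U2) (e3 : 'I_q -> U3) p :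
  bsquare (\sum_(i < m) \sum_(j < n) \sum_(k < q)
             c i j k *: tprod (e1 i) (tprod (e2 j) (e3 k))) p =
  \sum_(i < m) \sum_(j < n) \sum_(k < q) \sum_(l < p)
    c i j k *: tprod (e1 i)
                 (tprod (tprod_right U2 (delta_mx 0 l : 'rV[F]_p) (e2 j))
                        (tprod_right U3 (delta_mx 0 l : 'rV[F]_p) (e3 k))).
Proof.
rewrite /bsquare; under eq_bigr do rewrite linear_sum.
rewrite exchange_big; apply: eq_bigr => i _ /=.
under eq_bigr do rewrite linear_sum.
rewrite exchange_big; apply: eq_bigr => j _ /=.
under eq_bigr do rewrite linear_sum.
rewrite exchange_big; apply: eq_bigr => k _ /=; apply: eq_bigr => l _.
by rewrite linearZ /= /tmap3 !tmap_tprod !tprod_rightE id_lfunE.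
Qed.

End Tensors.

(* Since C is infinite, the identity in C[eps] is stated as equality of the
   two polynomial functions at every complex number x.  The tensor S_{s+1} of
   the definition is [Ss s], with s < e. *)
Definition degenerates (R : realType) (U1 U2 U3 V1 V2 V3 : vectType R[i])
    (T : tens3 U1 U2 U3) (S : tens3 V1 V2 V3) : Prop :=
  exists (A1 : seq 'Hom(U1, V1)) (A2 : seq 'Hom(U2, V2))
         (A3 : seq 'Hom(U3, V3)) (d e : nat) (Ss : 'I_e -> tens3 V1 V2 V3),
  forall x : R[i],
    tmap3 (poly_map A1 x) (poly_map A2 x) (poly_map A3 x) T =
    x ^+ d *: S + \sum_(s < e) x ^+ (d + s.+1) *: Ss s.

(* Main.v *)
Require Import Defs.
From mathcomp Require Import all_boot all_order all_algebra.
From mathcomp Require Import reals complex.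

(** Read a tensor in U1 (x) U2 (x) U3 as a linear map from the dual of U1 to
    U2 (x) U3, that is, forget that U2 (x) U3 is itself a tensor product.  A
    degeneration of T to S then becomes a family of maps M(x) T N(x) equal to
    x^d (S + x(...)), and such a family exhibits S as M T N for fixed linear
    maps M and N: this is the lower semicontinuity of the rank of linear maps,
    and it holds because invertibility is an open condition (lemma
    [limit_factor]).

    N is the transpose of a map B1 from U1 to V1 ([dual_map_surj]).  The map M
    from U2 (x) U3 to V2 (x) V3 does not respect the tensor structure, but M
    lies in the tensor product of Hom(U2, V2) and Hom(U3, V3); since Hom(U3, V3)
    has dimension u3 v3, M is a sum of u3 v3 maps of the form B (x) E
    ([hom_tens_decomp]).  Finally, the p copies of T inside its p-fold
    Kronecker product can be mapped independently in the second and third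
    factors, with the same map in the first, so that this product restricts to
    any sum of p terms (B1 (x) B_l (x) E_l) T ([bsquare_restricts_sum]). *)

Section Proof.

Import GRing.Theory passmx.
Local Open Scope ring_scope.
Local Set Implicit Arguments.
Local Unset Strict Implicit.

(** * Linear maps degenerate only to linear maps of smaller rank *)

(** The determinant is a polynomial in x whose value at 0 is 1, so that it
    vanishes at finitely many points only. *)
Lemma unitmx_deformation (F : closedFieldType) n e (N : 'I_e -> 'M[F]_n) :
  exists2 x : F, x != 0 & 1%:M + \sum_(s < e) x ^+ s.+1 *: N s \in unitmx.
Proof.
pose P : 'M[{poly F}]_n :=
  1%:M + \sum_(s < e) 'X^(s.+1) *: map_mx (@polyC F) (N s).
have PE x : map_mx (horner_eval x) P = 1%:M + \sum_(s < e) x ^+ s.+1 *: N s.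
  apply/matrixP=> i j; rewrite !mxE /horner_eval hornerD !summxE horner_sum.
  congr (_ + _); first by case: (i == j); rewrite ?mulr1n ?mulr0n hornerE.
  by apply: eq_bigr => s _; rewrite !mxE hornerM hornerXn hornerC.
have detE x : (\det P).[x] = \det (1%:M + \sum_(s < e) x ^+ s.+1 *: N s).
  by rewrite -PE det_map_mx.
have det0 : (\det P).[0] = 1.
  rewrite detE big1 ?addr0 ?det1 // => s _.
  by rewrite expr0n scale0r.
(* The factor 'X keeps the chosen point away from 0. *)
have /closed_nonrootP[x] : 'X * \det P != 0.
  rewrite mulf_neq0 ?polyX_eq0 //; apply/eqP => P0.
  by move: det0; rewrite P0 horner0 => /esym/eqP; rewrite oner_eq0.
rewrite rootE hornerM hornerX mulf_eq0 negb_or => /andP[x0 Px].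
by exists x => //; rewrite unitmxE unitfE -detE.
Qed.

Lemma lker0_deformation (F : closedFieldType) (V : vectType F) e
    (N : 'I_e -> 'End(V)) :
  exists2 x : F, x != 0 & lker (\1 + \sum_(s < e) x ^+ s.+1 *: N s)%VF == 0%VS.
Proof.
pose b := vbasis {:V}; have bP : basis_of {:V} b := vbasisP _.
have [x x0 xU] := unitmx_deformation (fun s => mxof b b (N s)).
exists x => //; rewrite -subv0; apply/subvP => v; rewrite memv_ker => /eqP Gv.
rewrite memv0; apply/eqP.
have := congr1 (rVof b) Gv.
rewrite (rVof_app b bP) linear0 linearD linear_sum /= mxof1 ?(basis_free bP) //.
under eq_bigr do rewrite linearZ.
move=> /(canRL (mulmxK xU)); rewrite mul0mx => v0.
by rewrite -(rVofK bP v) v0 linear0.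
Qed.

(** A limit S of maps x^-d M(x) T N(x) factors through T.  With S^-1 a
    generalized inverse of S (so that S S^-1 S = S) and F(x) = S + x(...) the
    normalized family, G(x) = F(x) S^-1 + (1 - S S^-1) equals 1 + x(...), hence
    is invertible for some nonzero x, while G(x) S = F(x) S^-1 S; thus
    S = G(x)^-1 F(x) S^-1 S. *)
Lemma limit_factor (F : closedFieldType) (X Y X' Y' : vectType F)
    (T : 'Hom(X, Y)) (S : 'Hom(X', Y')) (M : F -> 'Hom(Y, Y'))
    (N : F -> 'Hom(X', X)) d e (Ss : 'I_e -> 'Hom(X', Y')) :
  (forall x, (M x \o (T \o N x))%VF =
             x ^+ d *: S + \sum_(s < e) x ^+ (d + s.+1) *: Ss s) ->
  exists (M0 : 'Hom(Y, Y')) (N0 : 'Hom(X', X)), S = (M0 \o (T \o N0))%VF.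
Proof.
move=> MTN.
have [x x0 Gx] := lker0_deformation (fun s => (Ss s \o S^-1)%VF).
set G := (_ + _)%R in Gx.
exists (x ^- d *: (G^-1 \o M x))%VF, (N x \o (S^-1 \o S))%VF.
apply/lfunP => u.
set w := (S^-1 (S u))%VF.
have SwE : S w = S u by rewrite /w limg_lfunVK ?memv_img ?memvf.
have GS : G (S u) = x ^- d *: M x (T (N x w)).
  have -> : M x (T (N x w)) = (M x \o (T \o N x))%VF w by rewrite !comp_lfunE.
  rewrite MTN [in RHS]add_lfunE scale_lfunE SwE scalerDr scalerA mulVf ?expf_neq0 //.
  rewrite scale1r !add_lfunE id_lfunE !sum_lfunE scaler_sumr; congr (_ + _).
  apply: eq_bigr => s _.
  by rewrite !scale_lfunE comp_lfunE scalerA exprD mulKf ?expf_neq0.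
rewrite comp_lfunE scale_lfunE !comp_lfunE -/w -linearZ /= -GS.
by rewrite lker0_lfunK.
Qed.

(** * Tensor products and duals *)

Definition vcoord (F : fieldType) (V : vectType F) (i : 'I_(\dim {:V})) :
  dual V := linfun (coord (vbasis {:V}) i : V -> F^o).

Lemma vcoordE (F : fieldType) (V : vectType F) i (v : V) :
  vcoord i v = coord (vbasis {:V}) i v.
Proof. by rewrite lfunE. Qed.

Lemma dual_expand (F : fieldType) (V : vectType F) (f : dual V) :
  f = \sum_(i < \dim {:V}) f (vbasis {:V})`_i *: vcoord i.
Proof.
apply/lfunP => v; rewrite sum_lfunE {1}(coord_vbasis (memvf v)) linear_sum /=.
apply: eq_bigr => i _; rewrite linearZ scale_lfunE vcoordE.
by rewrite /GRing.scale /= mulrC.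
Qed.

Lemma tens_vbasis (F : fieldType) (U V : vectType F) (t : tens U V) :
  t = \sum_(i < \dim {:U}) tprod (vbasis {:U})`_i (t (vcoord i)).
Proof. exact/tens_expand/vbasisP. Qed.

(** The transpose of N becomes a map between the spaces themselves because
    finite-dimensional spaces are reflexive. *)
Lemma dual_map_surj (F : fieldType) (U V : vectType F)
    (N : 'Hom(dual V, dual U)) :
  exists B : 'Hom(U, V), dual_map B = N.
Proof.
pose g (u : U) := \sum_j N (vcoord j) u *: (vbasis {:V})`_j.
have gP : linear g.
  move=> a u v; rewrite /g scaler_sumr -big_split; apply: eq_bigr => j _ /=.
  by rewrite linearP scalerDl scalerA.
exists (linfun g); apply/lfunP => f; apply/lfunP => u.
rewrite dual_mapE comp_lfunE linfun_linearE // linear_sum /=.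
rewrite {2}(dual_expand f) linear_sum sum_lfunE; apply: eq_bigr => j _.
by rewrite !linearZ /= scale_lfunE /GRing.scale /= mulrC.
Qed.

(** This is the map u (x) v |-> f(v) u.  A basis of U appears because
    composing t : U^* -> V with f only gives an element of the bidual of U. *)
Definition contract (F : fieldType) (U V : vectType F) (f : dual V) :
    'Hom(tens U V, U) :=
  linfun (fun t : tens U V => \sum_i f (t (vcoord i)) *: (vbasis {:U})`_i).

Lemma contractE (F : fieldType) (U V : vectType F) (f : dual V)
    (t : tens U V) :
  contract U f t = \sum_i f (t (vcoord i)) *: (vbasis {:U})`_i.
Proof.
rewrite /contract linfun_linearE // => a t1 t2.
rewrite scaler_sumr -big_split; apply: eq_bigr => j _ /=.
by rewrite add_lfunE scale_lfunE linearP scalerDl scalerA.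
Qed.

Lemma contract_tprod (F : fieldType) (U V : vectType F) (f : dual V) u v :
  contract U f (tprod u v) = f v *: u.
Proof.
rewrite contractE {2}(coord_vbasis (memvf u)) scaler_sumr.
apply: eq_bigr => i _; rewrite tprodE linearZ vcoordE scalerA.
by rewrite /GRing.scale /= mulrC.
Qed.

Lemma tprod_sumr (F : fieldType) (U V : vectType F) (I : finType) u
    (v : I -> V) :
  tprod u (\sum_i v i) = \sum_i tprod u (v i) :> tens U V.
Proof.
by apply/lfunP => f; rewrite sum_lfunE tprodE scaler_sumr;
  apply: eq_bigr => i _; rewrite tprodE.
Qed.

Lemma tprodZl (F : fieldType) (U V : vectType F) a (u : U) (v : V) :
  tprod (a *: u) v = a *: tprod u v.
Proof. by apply/lfunP => f; rewrite scale_lfunE !tprodE linearZ scalerA. Qed.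

Lemma tprodZr (F : fieldType) (U V : vectType F) a (u : U) (v : V) :
  tprod u (a *: v) = a *: tprod u v.
Proof.
by apply/lfunP => f; rewrite scale_lfunE !tprodE !scalerA mulrC.
Qed.

Lemma tprod_suml (F : fieldType) (U V : vectType F) (I : finType)
    (u : I -> U) v :
  tprod (\sum_i u i) v = \sum_i tprod (u i) v :> tens U V.
Proof.
by apply/lfunP => f; rewrite sum_lfunE tprodE linear_sum scaler_suml;
  apply: eq_bigr => i _; rewrite tprodE.
Qed.

Lemma tens_contract (F : fieldType) (U V : vectType F) (t : tens U V) :
  t = \sum_i tprod (contract U (vcoord i) t) (vbasis {:V})`_i.
Proof.
rewrite {1}(tens_vbasis t).
under [RHS]eq_bigr do rewrite contractE tprod_suml.
rewrite exchange_big; apply: eq_bigr => i _ /=.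
rewrite {1}(coord_vbasis (memvf (t (vcoord i)))) tprod_sumr.
by apply: eq_bigr => j _; rewrite tprodZl tprodZr vcoordE.
Qed.

Lemma tens_homP (F : fieldType) (U V W : vectType F)
    (f g : 'Hom(tens U V, W)) :
  (forall u (k : 'I_(\dim {:V})),
     f (tprod u (vbasis {:V})`_k) = g (tprod u (vbasis {:V})`_k)) -> f = g.
Proof.
move=> fg; apply/lfunP => t; rewrite (tens_contract t) !linear_sum.
by apply: eq_bigr => k _; apply: fg.
Qed.

(** * Maps between tensor products *)

(** Hom(U (x) V, U' (x) V') = Hom(U, U') (x) Hom(V, V'): every M expands over
    the basis of elementary maps v |-> f_k(v) e_m of Hom(V, V'), its component
    there being the block U -> U' of M at position (k, m). *)
Lemma hom_tens_decomp (F : fieldType) (U V U' V' : vectType F)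
    (M : 'Hom(tens U V, tens U' V')) :
  exists (B : 'I_(\dim {:V} * \dim {:V'}) -> 'Hom(U, U'))
         (E : 'I_(\dim {:V} * \dim {:V'}) -> 'Hom(V, V')),
    M = \sum_l tmap (B l) (E l).
Proof.
pose b (k : 'I_(\dim {:V})) (m : 'I_(\dim {:V'})) : 'Hom(U, U') :=
  (contract U' (vcoord m) \o (M \o tprod_right U (vbasis {:V})`_k))%VF.
pose c (k : 'I_(\dim {:V})) (m : 'I_(\dim {:V'})) : 'Hom(V, V') :=
  linfun (fun v => vcoord k v *: (vbasis {:V'})`_m).
have cE k m v : c k m v = vcoord k v *: (vbasis {:V'})`_m.
  by rewrite linfun_linearE // => a w w'; rewrite linearP scalerDl scalerA.
have [h hK _] := curry_mxvec_bij (\dim {:V}) (\dim {:V'}).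
exists (fun l => b (h l).1 (h l).2), (fun l => c (h l).1 (h l).2).
rewrite (reindex _ (curry_mxvec_bij _ _)) /=.
rewrite (eq_bigr (fun km => tmap (b km.1 km.2) (c km.1 km.2))); last first.
  by move=> km _; rewrite hK.
rewrite -(pair_bigA _ (fun k m => tmap (b k m) (c k m))) /=.
apply: tens_homP => u k; rewrite sum_lfunE (bigD1 k) //= [X in _ + X]big1.
  rewrite addr0 sum_lfunE [LHS]tens_contract; apply: eq_bigr => m _.
  rewrite tmap_tprod cE vcoordE coord_free ?(basis_free (vbasisP _)) // eqxx.
  by rewrite scale1r !comp_lfunE tprod_rightE.
move=> k' /negPf k'k; rewrite sum_lfunE big1 // => m _.
rewrite tmap_tprod cE vcoordE coord_free ?(basis_free (vbasisP _)) //.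
by rewrite eq_sym k'k tprodZr scale0r.
Qed.

Lemma tmap_comp (F : fieldType) (U U' U'' V V' V'' : vectType F)
    (A' : 'Hom(U', U'')) (A : 'Hom(U, U')) (B' : 'Hom(V', V''))
    (B : 'Hom(V, V')) :
  (tmap A' B' \o tmap A B = tmap (A' \o A) (B' \o B))%VF.
Proof.
apply/lfunP => t; apply/lfunP => f.
rewrite comp_lfunE !tmapE !comp_lfunE !dual_mapE; congr (B' (B (t _))).
by apply/lfunP => u; rewrite !comp_lfunE.
Qed.

Lemma sum_tmap3 (F : fieldType) (U1 U2 U3 V1 V2 V3 : vectType F)
    (T : tens3 U1 U2 U3) (I : finType) (B1 : 'Hom(U1, V1))
    (B : I -> 'Hom(U2, V2)) (E : I -> 'Hom(U3, V3)) :
  ((\sum_l tmap (B l) (E l))%R \o (T \o dual_map B1))%VF =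
  \sum_l tmap3 B1 (B l) (E l) T.
Proof.
apply/lfunP => f; rewrite comp_lfunE !sum_lfunE.
by apply: eq_bigr => l _; rewrite /tmap3 [in RHS]tmapE [in RHS]comp_lfunE.
Qed.

(** The map from U (x) F^p that is B_l on the copy U (x) e_l of U. *)
Definition glue (F : fieldType) (U V : vectType F) p
    (B : 'I_p -> 'Hom(U, V)) : 'Hom(tens U 'rV[F]_p, V) :=
  \sum_l (B l \o contract U (linfun (fun v : 'rV[F]_p => v 0 l : F^o)))%VF.

Lemma glue_tprod_right (F : fieldType) (U V : vectType F) p
    (B : 'I_p -> 'Hom(U, V)) l :
  (glue B \o tprod_right U (delta_mx 0 l))%VF = B l.
Proof.
apply/lfunP => u; rewrite comp_lfunE tprod_rightE sum_lfunE (bigD1 l) //=.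
have E m : linfun (fun v : 'rV[F]_p => v 0 m : F^o) (delta_mx 0 l) = (m == l)%:R.
  by rewrite linfun_linearE ?mxE // => a v w; rewrite !mxE.
rewrite comp_lfunE contract_tprod E eqxx scale1r big1 ?addr0 // => m /negPf ml.
by rewrite comp_lfunE contract_tprod E ml scale0r linear0.
Qed.

Lemma bsquare_restricts_sum (F : fieldType) (U1 U2 U3 V1 V2 V3 : vectType F)
    (T : tens3 U1 U2 U3) p (B1 : 'Hom(U1, V1)) (B : 'I_p -> 'Hom(U2, V2))
    (E : 'I_p -> 'Hom(U3, V3)) :
  restricts (bsquare T p) (\sum_l tmap3 B1 (B l) (E l) T).
Proof.
exists B1, (glue B), (glue E); rewrite linear_sum; apply: eq_bigr => l _ /=.
by rewrite /tmap3 -comp_lfunE !tmap_comp !glue_tprod_right comp_lfun1r.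
Qed.

End Proof.

Theorem lemma4p2 (R : realType) (U1 U2 U3 V1 V2 V3 : vectType R[i])
    (T : tens3 U1 U2 U3) (S : tens3 V1 V2 V3) :
  degenerates T S ->
  restricts (bsquare T (\dim {:U3} * \dim {:V3})) S.
Proof.
move=> [A1 [A2 [A3 [d [e [Ss AT]]]]]].
have [|M [N ->]] := @limit_factor _ _ _ _ _ T S
    (fun x => tmap (poly_map A2 x) (poly_map A3 x))
    (fun x => dual_map (poly_map A1 x)) d e Ss.
  (* A three-fold product of maps acts on T, seen as a linear map, by
     composition on both sides. *)
  by move=> x; rewrite -AT /tmap3 tmapE.
have [B1 <-] := dual_map_surj N; have [B [E ->]] := hom_tens_decomp M.
rewrite sum_tmap3; exact: bsquare_restricts_sum.
Qed.
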